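(* Suppose that assumptions (P1)–(P9) of the context hold. Then for $m$-a.e. $\omega\in\Omega$ such that $\Delta_{\omega,\epsilon}>0$ for all $\epsilon>0$, $$\lim_{\epsilon\to0}\frac{\lambda_{\omega,0}-\lambda_{\omega,\epsilon}}{\Delta_{\omega,\epsilon}}=1-\sum_{k=0}^\infty\hat q_{\omega,0}^{(k)}=:\theta_{\omega,0}.$$
   Context: $(\Omega,\mathscr F,m)$ is a probability space and $\sigma:\Omega\to\Omega$ is an invertible ergodic $m$-preserving map (no measurability in $\omega$ of the objects below is required). $\{(\mathcal B_\omega,\|\cdot\|_{\mathcal B_\omega})\}_{\omega\in\Omega}$ is a family of normed vector spaces with dual spaces $(\mathcal B_\omega^*,\|\cdot\|_{\mathcal B^*_\omega})$, and for each $\omega\in\Omega$ and $0\le\epsilon\le\epsilon_0$ there is a linear operator $\mathcal L_{\omega,\epsilon}:\mathcal B_\omega\to\mathcal B_{\sigma\omega}$. Write $\mathcal L_{\omega,\epsilon}^n=\mathcal L_{\sigma^{n-1}\omega,\epsilon}\circ\dots\circ\mathcal L_{\omega,\epsilon}$, and similarly $Q_{\omega,\epsilon}^n$; $\lambda^n_{\omega,\epsilon}=\prod_{j=0}^{n-1}\lambda_{\sigma^j\omega,\epsilon}$. Assumptions (for every $\omega\in\Omega$; $\sup_{\epsilon\ge0}$ is over $0\le\epsilon\le\epsilon_0$): (P1) There is $C_1:\Omega\to\mathbb R_+$ with $\sup_{\epsilon\ge0}\|\mathcal L_{\omega,\epsilon}(f)\|_{\mathcal B_{\sigma\omega}}\le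 C_1(\omega)\|f\|_{\mathcal B_\omega}$ for $f\in\mathcal B_\omega$. (P2) For each $\epsilon\ge0$ there are $\nu_{\omega,\epsilon}\in\mathcal B_\omega^*$, $\lambda_{\omega,\epsilon}\in\mathbb C\setminus\{0\}$, $\phi_{\omega,\epsilon}\in\mathcal B_\omega$ with $\mathcal L_{\omega,\epsilon}(\phi_{\omega,\epsilon})=\lambda_{\omega,\epsilon}\phi_{\sigma\omega,\epsilon}$ and $\nu_{\sigma\omega,\epsilon}(\mathcal L_{\omega,\epsilon}(f))=\lambda_{\omega,\epsilon}\nu_{\omega,\epsilon}(f)$ for all $f\in\mathcal B_\omega$; moreover $\nu_{\omega,0}(\phi_{\omega,\epsilon})=1$. (P3) There is an operator $Q_{\omega,\epsilon}:\mathcal B_\omega\to\mathcal B_{\sigma\omega}$ with $\lambda_{\omega,\epsilon}^{-1}\mathcal L_{\omega,\epsilon}(f)=\nu_{\omega,\epsilon}(f)\phi_{\sigma\omega,\epsilon}+Q_{\omega,\epsilon}(f)$ for $f\in\mathcal B_\omega$, and $Q_{\omega,\epsilon}(\phi_{\omega,\epsilon})=0$, $\nu_{\sigma\omega,\epsilon}(Q_{\omega,\epsilon}(f))=0$. (P4) There is $C_2:\Omega\to\mathbb R_+$ with $\sup_{\epsilon\ge0}\|\phi_{\omega,\epsilon}\|_{\mathcal B_\omega}=C_2(\omega)<\infty$. Put $\Delta_{\omega,\epsilon}:=\nu_{\sigma\omega,0}\big((\mathcal L_{\omega,0}-\mathcal L_{\omega,\epsilon})(\phi_{\omega,0})\big)$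 and $\eta_{\omega,\epsilon}:=\|\nu_{\sigma\omega,0}\circ(\mathcal L_{\omega,0}-\mathcal L_{\omega,\epsilon})\|_{\mathcal B_\omega^*}$. (P5) $\lim_{\epsilon\to0}\eta_{\omega,\epsilon}=0$. (P6) If $\Delta_{\omega,\epsilon}>0$ for every $\epsilon>0$, then $C_3(\omega):=\limsup_{\epsilon\to0}\eta_{\omega,\epsilon}/\Delta_{\omega,\epsilon}<\infty$. If there is $\epsilon_0'>0$ with $\Delta_{\omega,\epsilon}=0$ for all $\epsilon\le\epsilon_0'$, then $\eta_{\omega,\epsilon}=0$ for all $\epsilon\le\epsilon_0'$. (P7) $\lim_{\epsilon\to0}\nu_{\omega,\epsilon}(\phi_{\omega,0})=1$. (P8) If $\Delta_{\omega,\epsilon}>0$ for all $\epsilon>0$, then $\lim_{n\to\infty}\limsup_{\epsilon\to0}\Delta_{\omega,\epsilon}^{-1}\,\nu_{\sigma\omega,0}\big((\mathcal L_{\omega,0}-\mathcal L_{\omega,\epsilon})(Q^n_{\sigma^{-n}\omega,\epsilon}\phi_{\sigma^{-n}\omega,0})\big)=0$. (P9) If $\Delta_{\omega,\epsilon}>0$ for all $\epsilon>0$, then for each $k\ge0$ the limit $$q_{\omega,0}^{(k)}:=\lim_{\epsilon\to0}\frac{\nu_{\sigma\omega,0}\big((\mathcal L_{\omega,0}-\mathcal L_{\omega,\epsilon})\,\mathcal L^k_{\sigma^{-k}\omega,\epsilon}\,(\mathcal L_{\sigma^{-(k+1)}\omega,0}-\mathcal L_{\sigma^{-(k+1)}\omega,\epsilon})(\phi_{\sigma^{-(k+1)}\omega,0})\big)}{\nu_{\sigma\omega,0}\big((\mathcal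 L_{\omega,0}-\mathcal L_{\omega,\epsilon})(\phi_{\omega,0})\big)}$$ exists. Finally $\hat q_{\omega,0}^{(k)}:=\big(\lambda^{k+1}_{\sigma^{-(k+1)}\omega,0}\big)^{-1}q_{\omega,0}^{(k)}$. *)

(* Defs.v *)
From HB Require Import structures.
From mathcomp Require Import all_boot all_order all_algebra.
From mathcomp Require Import all_classical all_reals all_analysis.
From mathcomp Require Import complex.

Set Implicit Arguments.
Unset Strict Implicit.
Unset Printing Implicit Defensive.

Import Order.TTheory GRing.Theory Num.Theory.
Import numFieldNormedType.Exports.

Local Open Scope classical_set_scope.
Local Open Scope ring_scope.

(* The complex field is R[i] for R : realType; its
   copy R[i]^o carries the topology of the modulus. *)

Section measure_preserving.
Context (d : measure_display) (T : measurableType d) (R : realType).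

Definition measure_preserving (m : {measure set T -> \bar R}) (f : T -> T) :=
  measurable_fun setT f /\
  forall A, measurable A -> m (f @^-1` A) = m A.

Definition ergodic (m : probability T R) (f : T -> T) :=
  forall A, measurable A -> f @^-1` A = A -> m A = 0%E \/ m A = 1%E.

End measure_preserving.

Section norms.
Context (R : realType).

(* The norm of a normed space over R[i] is R[i]-valued with zero imaginary
   part; rnorm is the same norm as an element of R. *)
Definition rnorm (V : normedZmodType R[i]) (x : V) : R := complex.Re `|x|.

(* The value is +oo exactly when g is unbounded on the unit ball. *)
Definition dual_norm (V : normedModType R[i]) (g : V -> R[i]) : \bar R :=
  ereal_sup [set (rnorm (g f))%:E | f in [set f : V | rnorm f <= 1]].

End norms.

Definition transport (T : Type) (B : T -> Type) (x y : T) (e : x = y) :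
  B x -> B y := fun b => eq_rect x B b y e.

Lemma iter_cancel (T : Type) (f g : T -> T) (gK : cancel g f) (n : nat) (x : T) :
  iter n f (iter n g x) = x.
Proof. by elim: n => //= n IHn; rewrite -iterS iterSr gK. Qed.

Section cocycle.
Context (R : realType) (T : Type) (sigma tau : T -> T).
(* tau is the inverse of sigma, so that iter n tau w is sigma^{-n} w. *)
Context (tauK : cancel tau sigma).
Context (B : T -> normedModType R[i]).
Local Notation fibre := (fun w : T => B w : Type).

Definition iter_op (A : forall w, R -> B w -> B (sigma w)) :=
  fix iter_op (n : nat) (w : T) (e : R) : B w -> B (iter n sigma w) :=
    match n with
    | 0 => id
    | n'.+1 => fun f => A (iter n' sigma w) e (iter_op n' w e f)
    end.

(* A^n at sigma^{-n} w, with codomain sigma^n (sigma^{-n} w) identified with w. *)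
Definition iter_op_to (A : forall w, R -> B w -> B (sigma w))
    (n : nat) (w : T) (e : R) (f : B (iter n tau w)) : B w :=
  transport (B := fibre) (iter_cancel tauK n w) (iter_op A n e f).

Definition iter_lam (lam : T -> R -> R[i]) (n : nat) (w : T) (e : R) : R[i] :=
  \prod_(j < n) lam (iter j sigma w) e.

Context (L Q : forall w, R -> {linear B w -> B (sigma w)}).
Context (nu : forall w, R -> {linear B w -> R[i]^o}).
Context (lam : T -> R -> R[i]).
Context (phi : forall w, R -> B w).

Definition dL (w : T) (e : R) : B w -> B (sigma w) := L w 0 \- L w e.

Definition nu_dL (w : T) (e : R) : B w -> R[i] := nu (sigma w) 0 \o dL (w := w) e.

Definition Delta (w : T) (e : R) : R[i] := nu_dL e (phi w 0).

Definition eta (w : T) (e : R) : \bar R := dual_norm (@nu_dL w e).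

(* The operators are given for 0 <= e <= eps0; nothing is assumed about their
   values at other e. The limits e -> 0 are taken along 0^'+, i.e. 0 < e. *)
Context (eps0 : R).

Definition eps_range : set R := [set e | 0 <= e <= eps0].

(* The order of R[i] makes 0 < z mean that z is real and positive. *)
Definition Delta_pos (w : T) : Prop :=
  forall e, 0 < e <= eps0 -> 0 < Delta w e.

Definition uniformly_bounded : Prop :=
  exists C1 : T -> R, (forall w, 0 <= C1 w) /\
    forall w (f : B w),
      (ereal_sup [set (rnorm (L w e f))%:E | e in eps_range]
         <= (C1 w * rnorm f)%:E)%E.

Definition eigen_triple : Prop :=
  forall w e, eps_range e ->
    [/\ continuous (nu w e : B w -> R[i]^o),
        lam w e != 0,
        L w e (phi w e) = lam w e *: phi (sigma w) e,
        (forall f : B w, nu (sigma w) e (L w e f) = lam w e * nu w e f)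
      & nu w 0 (phi w e) = 1].

Definition spectral_decomposition : Prop :=
  forall w e, eps_range e ->
    [/\ (forall f : B w, (lam w e)^-1 *: L w e f =
                          nu w e f *: phi (sigma w) e + Q w e f),
        Q w e (phi w e) = 0
      & forall f : B w, nu (sigma w) e (Q w e f) = 0].

Definition phi_bounded : Prop :=
  exists C2 : T -> R, (forall w, 0 <= C2 w) /\
    forall w, ereal_sup [set (rnorm (phi w e))%:E | e in eps_range] = (C2 w)%:E.

Definition eta_cvg0 : Prop :=
  forall w, eta w e @[e --> 0^'+] --> 0%E.

Definition eta_controlled_by_Delta : Prop :=
  forall w,
    (Delta_pos w ->
       (limf_esup (fun e : R => eta w e * ((complex.Re (Delta w e))^-1)%:E)
                  0^'+ < +oo)%E) /\
    (forall eps0', 0 < eps0' ->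
       (forall e, eps_range e -> e <= eps0' -> Delta w e = 0) ->
       forall e, eps_range e -> e <= eps0' -> eta w e = 0%E).

Definition nu_phi_cvg1 : Prop :=
  forall w, nu w e (phi w 0) @[e --> 0^'+] --> (1 : R[i]^o).

(* The quantity under the limsup is complex, hence the modulus. *)
Definition remainder_vanishes : Prop :=
  forall w, Delta_pos w ->
    limf_esup (fun e : R =>
        (rnorm ((Delta w e)^-1 *
           nu_dL e (iter_op_to Q e (phi (iter n tau w) 0))))%:E) 0^'+
      @[n --> \oo] --> 0%E.

(* dL at sigma^{-(k+1)} w takes values in the fibre over
   sigma (sigma^{-(k+1)} w), which is identified with sigma^{-k} w. *)
Definition q_ratio (k : nat) (w : T) (e : R) : R[i]^o :=
  nu_dL e (iter_op_to L e
    (transport (B := fibre) (tauK (iter k tau w))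
       (dL e (phi (iter k.+1 tau w) 0))))
  / Delta w e.

Definition q_limits_exist : Prop :=
  forall w, Delta_pos w -> forall k, cvg (q_ratio k w e @[e --> 0^'+]).

Definition q (k : nat) (w : T) : R[i]^o := lim (q_ratio k w e @[e --> 0^'+]).

Definition qhat (k : nat) (w : T) : R[i]^o :=
  (iter_lam lam k.+1 (iter k.+1 tau w) 0)^-1 * (q k w : R[i]).

Definition theta (w : T) : R[i]^o := 1 - limn (series (qhat ^~ w)).

End cocycle.

(* Main.v *)
Require Import Defs.
From HB Require Import structures.
From mathcomp Require Import all_boot all_order all_algebra.
From mathcomp Require Import all_classical all_reals all_analysis.
From mathcomp Require Import complex ring.

Set Implicit Arguments.
Unset Strict Implicit.
Unset Printing Implicit Defensive.

Import Order.TTheory GRing.Theory Num.Theory.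
Import numFieldNormedType.Exports.

Local Open Scope classical_set_scope.
Local Open Scope ring_scope.

(** Fix w and write x_n = sigma^{-n} w, X(e) = (lam w 0 - lam w e) / Delta w e,
    g(f) = nu_{sigma w,0} ((L_{w,0} - L_{w,e}) f), and Lam_n(e) for the product
    of the n eigenvalues along the orbit from x_n to w.

    Three identities hold at each fixed e.
    - g(phi_{w,e}) = lam w 0 - lam w e: apply nu_{sigma w,0} to the eigenvector
      equation and use nu_{.,0}(phi_{.,e}) = 1 ([nu_dL_phi]).
    - For n >= 1, Lam_n(e)^-1 L_e^n f = nu_{x_n,e}(f) phi_{w,e} + Q_e^n f
      ([iter_L_decomposition]): at each step Q_e f stays in the kernel of nu_e,
      where L_e acts as lam_e Q_e.
    - Lam_n(0)^-1 L_e^n phi_{x_n,0} is phi_{w,0} minus the sum over k < n of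
      Lam_{k+1}(0)^-1 L_e^k (L_0 - L_e) phi_{x_{k+1},0} ([iter_L_telescope]).
    Applying g to the last two with f = phi_{x_n,0} and dividing by Delta gives
    the exact formula [eigenvalue_gap]
      nu_{x_n,e}(phi_{x_n,0}) X(e)
        = Lam_n(0)/Lam_n(e) (1 - sum_{k<n} Lam_{k+1}(0)^-1 q_ratio_k(e)) - r_n(e),
    where r_n(e) = g(Q_e^n phi_{x_n,0}) / Delta.

    Let e tend to 0 with n fixed. The prefactor on the left tends to 1 by
    hypothesis. The first identity gives |lam_0 - lam_e| <= C_2 eta -> 0 in every
    fibre ([lam_cvg]), so the quotient of the Lam_n tends to 1. Hence the main
    term tends to 1 - S_n, with S_n the n-th partial sum of the series of the
    qhat_k ([main_term_cvg]), and X(e) is within limsup_e |r_n(e)| of 1 - S_n, up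
    to an arbitrarily small error ([near_rnorm_gap]). These limsups tend to 0
    with n, so for n large S_n is close to 1 - X(e) for all e close enough to 0,
    how close depending on n ([gap_double_limit]). That forces S_n to be Cauchy and 1 - X(e) to converge
    to its limit ([complex_double_limit]). The argument works at every w, hence
    almost everywhere. *)

(** * Iterated operators on the fibres of a bundle *)

Section fibres.
Context (R : realType) (T : Type) (sigma tau : T -> T).
Context (tauK : cancel tau sigma) (B : T -> normedModType R[i]).
Local Notation fibre := (fun w : T => B w : Type).

Lemma transport_trans x y z (E : x = y) (E' : y = z) (f : B x) :
  transport (B := fibre) E' (transport (B := fibre) E f)
  = transport (B := fibre) (etrans E E') f.
Proof. by case: _ / E'; case: _ / E. Qed.

Lemma transport_linear x y (E : x = y) (c : R[i]) (f g : B x) :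
  transport (B := fibre) E (c *: f + g)
  = c *: transport (B := fibre) E f + transport (B := fibre) E g.
Proof. by case: _ / E. Qed.

Lemma transportZ x y (E : x = y) (c : R[i]) (f : B x) :
  transport (B := fibre) E (c *: f) = c *: transport (B := fibre) E f.
Proof. by case: _ / E. Qed.

Lemma transport_section x y (E : x = y) (phi : forall w, B w) :
  transport (B := fibre) E (phi x) = phi y.
Proof. by case: _ / E. Qed.

Lemma transport_form (nu : forall w, B w -> R[i]) x y (E : x = y) (f : B x) :
  nu y (transport (B := fibre) E f) = nu x f.
Proof. by case: _ / E. Qed.

(** Seen over the fibres x_n = sigma^{-n} w, an operator cocycle is a chain of
    maps from the fibre over x_{n+1} to the fibre over x_n. Its links are these
    maps; once iterates are expressed through them, the identification of
    sigma (tau x) with x need not be mentioned again. *)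
Definition step_into (A : forall w, R -> B w -> B (sigma w)) (x : T) (e : R)
    (f : B (tau x)) : B x :=
  transport (B := fibre) (tauK x) (A (tau x) e f).

Section iterates.
Variable A : forall w, R -> B w -> B (sigma w).

Lemma transport_op x y e (E : x = y) (f : B x) :
  A e (transport (B := fibre) E f)
  = transport (B := fibre) (congr1 sigma E) (A e f).
Proof. by case: _ / E. Qed.

Lemma transport_iter_op n x y e (E : x = y)
    (E' : iter n sigma x = iter n sigma y) (f : B x) :
  iter_op A n e (transport (B := fibre) E f)
  = transport (B := fibre) E' (iter_op A n e f).
Proof. by case: _ / E in E' *; rewrite (Prop_irrelevance E' erefl). Qed.

(** Any proof E will do, which spares callers from tracking a particular one. *)
Lemma iter_op_first n x e (f : B x)
    (E : iter n sigma (sigma x) = iter n.+1 sigma x) :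
  iter_op A n.+1 e f = transport (B := fibre) E (iter_op A n e (A e f)).
Proof.
elim: n E => [|n IHn] E /=; first by rewrite (Prop_irrelevance E erefl).
have E' : iter n sigma (sigma x) = iter n.+1 sigma x by rewrite -iterSr.
rewrite -[LHS]/(@A (iter n.+1 sigma x) e (iter_op A n.+1 e f)) (IHn E').
by rewrite (Prop_irrelevance E (congr1 sigma E')) transport_op.
Qed.

(** The iterate that ends at w is defined by applying the last operator last, at
    moving base points; peeling off the first operator instead keeps the target
    fixed at w, which is the recursion that every induction below uses. The
    transports on the two sides differ only in their equality proofs. *)
Lemma iter_op_to_first n w e (f : B (iter n.+1 tau w)) :
  iter_op_to tauK A e f
  = iter_op_to tauK A e (step_into A e f : B (iter n tau w)).
Proof.
rewrite /iter_op_to /step_into.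
have E : iter n sigma (sigma (iter n.+1 tau w))
  = iter n.+1 sigma (iter n.+1 tau w) by rewrite -iterSr.
have E' : iter n sigma (sigma (iter n.+1 tau w)) = iter n sigma (iter n tau w).
  by rewrite [in LHS]iterS tauK.
rewrite (iter_op_first e f E) (transport_iter_op e (tauK (iter n tau w)) E').
rewrite !transport_trans.
apply: (congr1 (fun E0 => transport (B := fibre) E0 _)).
exact: Prop_irrelevance.
Qed.

Lemma iter_op_to0 w e (f : B w) : iter_op_to tauK A (n := 0) e f = f.
Proof.
by rewrite /iter_op_to (Prop_irrelevance (iter_cancel tauK 0 w) erefl).
Qed.

End iterates.

Lemma step_into_linear (A : forall w, R -> {linear B w -> B (sigma w)}) x e
    (c : R[i]) (f g : B (tau x)) :
  step_into A e (c *: f + g) = c *: step_into A e f + step_into A e g.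
Proof. by rewrite /step_into linearP transport_linear. Qed.

Lemma iter_op_to_linear (A : forall w, R -> {linear B w -> B (sigma w)}) n w e
    (c : R[i]) (f g : B (iter n tau w)) :
  iter_op_to tauK A e (c *: f + g)
  = c *: iter_op_to tauK A e f + iter_op_to tauK A e g.
Proof.
elim: n => [|n IHn] in f g *; first by rewrite !iter_op_to0.
by rewrite !iter_op_to_first step_into_linear IHn.
Qed.

Lemma iter_op_to_0 (A : forall w, R -> {linear B w -> B (sigma w)}) n w e :
  iter_op_to tauK A e (0 : B (iter n tau w)) = 0.
Proof.
have := iter_op_to_linear A e (-1) (0 : B (iter n tau w)) 0.
by rewrite scaler0 addr0 scaleN1r addNr.
Qed.

Lemma iter_op_toZ (A : forall w, R -> {linear B w -> B (sigma w)}) n w e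
    (c : R[i]) (f : B (iter n tau w)) :
  iter_op_to tauK A e (c *: f) = c *: iter_op_to tauK A e f.
Proof. by rewrite -[c *: f]addr0 iter_op_to_linear iter_op_to_0 addr0. Qed.

Lemma iter_lam_first (lam : T -> R -> R[i]) n w e :
  iter_lam sigma lam n.+1 (iter n.+1 tau w) e
  = lam (iter n.+1 tau w) e * iter_lam sigma lam n (iter n tau w) e.
Proof.
rewrite /iter_lam big_ord_recl; congr (_ * _).
by apply: eq_bigr => i _; rewrite lift0 iterSr /= tauK.
Qed.

End fibres.

(** * The exact formula for the eigenvalue gap *)

Section spectral.
Context (R : realType) (T : Type) (sigma tau : T -> T).
Context (tauK : cancel tau sigma) (B : T -> normedModType R[i]).
Context (eps0 : R) (L Q : forall w, R -> {linear B w -> B (sigma w)}).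
Context (nu : forall w, R -> {linear B w -> R[i]^o}).
Context (lam : T -> R -> R[i]) (phi : forall w, R -> B w).
Hypothesis eigen : eigen_triple L nu lam phi eps0.
Hypothesis decomposition : spectral_decomposition L Q nu lam phi eps0.

Local Notation dL_op := (fun w e => @dL _ _ _ _ L w e).
Local Notation backward_lam n w e := (iter_lam sigma lam n (iter n tau w) e).

Lemma iter_lam_neq0 n w e : eps_range eps0 e -> iter_lam sigma lam n w e != 0.
Proof.
by move=> he; apply/prodf_neq0 => i _; have [] := eigen (iter i sigma w) he.
Qed.

Lemma step_into_phi x e : eps_range eps0 e ->
  step_into tauK L e (phi (tau x) e) = lam (tau x) e *: phi x e.
Proof.
move=> he; rewrite /step_into; have [_ _ -> _ _] := eigen (tau x) he.
by rewrite transportZ (transport_section _ (fun w => phi w e)).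
Qed.

Lemma step_into_decomposition x e (f : B (tau x)) : eps_range eps0 e ->
  step_into tauK L e f
  = lam (tau x) e *: (nu (tau x) e f *: phi x e + step_into tauK Q e f).
Proof.
move=> he; have [dec _ _] := decomposition (tau x) he.
have [_ lam_neq0 _ _ _] := eigen (tau x) he.
rewrite /step_into -(transport_section (tauK x) (fun w => phi w e)).
by rewrite -transport_linear -dec transportZ scalerA mulfV // scale1r.
Qed.

Lemma nu_step_into_Q x e (f : B (tau x)) : eps_range eps0 e ->
  nu x e (step_into tauK Q e f) = 0.
Proof.
move=> he; have [_ _ nuQ] := decomposition (tau x) he.
by rewrite /step_into (transport_form (fun w => nu w e : B w -> R[i])) nuQ.
Qed.

Lemma iter_L_phi n w e : eps_range eps0 e ->
  iter_op_to tauK L e (phi (iter n tau w) e) = backward_lam n w e *: phi w e.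
Proof.
move=> he; elim: n => [|n IHn].
  by rewrite iter_op_to0 /iter_lam big_ord0 scale1r.
rewrite iter_op_to_first step_into_phi // (iter_lam_first tauK) -scalerA -IHn.
exact: iter_op_toZ.
Qed.

(** On the kernel of the conformal functional L_e is lam_e Q_e, and Q_e maps
    into that kernel, so the comparison propagates along the orbit. *)
Lemma iter_L_ker_nu n w e (f : B (iter n tau w)) : eps_range eps0 e ->
  nu (iter n tau w) e f = 0 ->
  iter_op_to tauK L e f = backward_lam n w e *: iter_op_to tauK Q e f.
Proof.
move=> he; elim: n => [|n IHn] in f *.
  by rewrite !iter_op_to0 /iter_lam big_ord0 scale1r.
move=> nuf0; rewrite 2!iter_op_to_first step_into_decomposition //.
rewrite [nu _ _ _]nuf0 scale0r add0r iter_op_toZ IHn ?nu_step_into_Q //.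
by rewrite (iter_lam_first tauK) scalerA.
Qed.

(** The first step splits f into its component along the eigenvector, which is
    only rescaled afterwards, and a vector in the kernel of nu. At zero steps the
    identity would read f = nu(f) phi + f, whence n.+1. *)
Lemma iter_L_decomposition n w e (f : B (iter n.+1 tau w)) : eps_range eps0 e ->
  iter_op_to tauK L e f
  = backward_lam n.+1 w e *: (nu (iter n.+1 tau w) e f *: phi w e
                              + iter_op_to tauK Q e f).
Proof.
move=> he; rewrite 2!iter_op_to_first step_into_decomposition // iter_op_toZ.
rewrite iter_op_to_linear iter_L_phi // iter_L_ker_nu ?nu_step_into_Q //.
rewrite (iter_lam_first tauK) -scalerA; congr (_ *: _).
by rewrite scalerDr !scalerA mulrC.
Qed.

Lemma step_into_dL x e : eps_range eps0 0 ->
  step_into tauK L e (phi (tau x) 0)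
  = - 1 *: step_into tauK dL_op e (phi (tau x) 0)
    + lam (tau x) 0 *: phi x 0.
Proof.
move=> h0; rewrite -step_into_phi // /step_into -transport_linear.
by rewrite /dL scaleN1r /= opprB subrK.
Qed.

(** Replace L_0 by L_e one factor at a time, the factor nearest to w first. The
    factors still to be replaced act on an eigenvector of L_0, and contribute
    exactly the eigenvalue products that normalise qhat. *)
Lemma iter_L_telescope n w e : eps_range eps0 0 ->
  (backward_lam n w 0)^-1 *: iter_op_to tauK L e (phi (iter n tau w) 0)
  = phi w 0 - \sum_(k < n) (backward_lam k.+1 w 0)^-1 *:
      iter_op_to tauK L e
        (step_into tauK dL_op e (phi (iter k.+1 tau w) 0)
         : B (iter k tau w)).
Proof.
move=> h0; elim: n => [|n IHn].
  by rewrite iter_op_to0 /iter_lam !big_ord0 invr1 scale1r subr0.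
rewrite big_ord_recr opprD addrA -IHn iter_op_to_first.
rewrite (step_into_dL (iter n tau w)) // iter_op_to_linear iter_op_toZ.
rewrite scalerDr scaleN1r scalerN addrC scalerA.
have [_ lam_neq0 _ _ _] := eigen (iter n.+1 tau w) h0.
suff -> : (backward_lam n.+1 w 0)^-1 * lam (iter n.+1 tau w) 0
  = (backward_lam n w 0)^-1 by [].
by rewrite (iter_lam_first tauK) invfM mulrAC mulVf // mul1r.
Qed.

Lemma nu_dL_linear w e (c : R[i]) (f g : B w) :
  nu_dL L nu e (c *: f + g) = c * nu_dL L nu e f + nu_dL L nu e g.
Proof.
by rewrite /nu_dL /dL /= !(linearB, linearP) /= scalerN mulrBr addrACA.
Qed.

Lemma nu_dLD w e (f g : B w) :
  nu_dL L nu e (f + g) = nu_dL L nu e f + nu_dL L nu e g.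
Proof. by rewrite -[f in LHS]scale1r nu_dL_linear mul1r. Qed.

Lemma nu_dL0 w e : nu_dL L nu e (0 : B w) = 0.
Proof. by apply: (addrI (nu_dL L nu e (0 : B w))); rewrite -nu_dLD !addr0. Qed.

Lemma nu_dLZ w e (c : R[i]) (f : B w) :
  nu_dL L nu e (c *: f) = c * nu_dL L nu e f.
Proof. by rewrite -[c *: f]addr0 nu_dL_linear nu_dL0 addr0. Qed.

Lemma nu_dLB w e (f g : B w) :
  nu_dL L nu e (f - g) = nu_dL L nu e f - nu_dL L nu e g.
Proof. by rewrite -scaleN1r addrC nu_dL_linear mulN1r addrC. Qed.

Lemma nu_dL_sum w e n (c : 'I_n -> R[i]) (f : 'I_n -> B w) :
  nu_dL L nu e (\sum_(k < n) c k *: f k)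
  = \sum_(k < n) c k * nu_dL L nu e (f k).
Proof.
rewrite (big_morph _ (@nu_dLD w e) (@nu_dL0 w e)).
by under eq_bigr do rewrite nu_dLZ.
Qed.

Lemma nu_dL_phi w e : eps_range eps0 0 -> eps_range eps0 e ->
  nu_dL L nu e (phi w e) = lam w 0 - lam w e.
Proof.
move=> h0 he; rewrite /nu_dL /dL /= linearB /=.
have [_ _ _ nuL0 _] := eigen w h0; have [_ _ -> _ nue] := eigen w he.
have [_ _ _ _ nues] := eigen (sigma w) he.
by rewrite nuL0 nue linearZ /= nues mulr1 [_%:A]mulr1.
Qed.

(** Equate the two expressions for the normalised L_e^{n+1} phi_{x,0}, with x the
    (n+1)-st backward image of w, apply nu_{sigma w,0} o (L_0 - L_e), and divide
    by Delta. *)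
Lemma eigenvalue_gap n w e : eps_range eps0 0 -> eps_range eps0 e ->
  Delta L nu phi w e != 0 ->
  nu (iter n.+1 tau w) e (phi (iter n.+1 tau w) 0)
    * ((lam w 0 - lam w e) / Delta L nu phi w e)
  = backward_lam n.+1 w 0 / backward_lam n.+1 w e
    * (1 - \sum_(k < n.+1) (backward_lam k.+1 w 0)^-1
                          * q_ratio tauK L nu phi k w e)
    - (Delta L nu phi w e)^-1
      * nu_dL L nu e (iter_op_to tauK Q e (phi (iter n.+1 tau w) 0)).
Proof.
move=> h0 he D_neq0.
have := iter_L_telescope n.+1 w e h0.
rewrite iter_L_decomposition // scalerA.
move=> /(congr1 (@nu_dL _ _ _ _ L nu w e)).
rewrite nu_dLZ nu_dL_linear nu_dL_phi // nu_dLB nu_dL_sum.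
(* Over an arbitrary field, so that the orbit quantities stay atoms. *)
have rearrange (F : fieldType) (l0 le a g r D S : F) : l0 != 0 -> le != 0 ->
    D != 0 -> l0^-1 * le * (a * g + r) = D - S ->
    a * (g / D) = l0 / le * (1 - S / D) - D^-1 * r.
  move=> l0_neq0 le_neq0 D_neq0' E.
  have -> : 1 - S / D = l0^-1 * le * (a * g + r) / D.
    by rewrite E mulrBl divff.
  by field; apply/and3P.
move=> E; rewrite (_ : \sum_(k < n.+1) _ =
  (\sum_(k < n.+1) (backward_lam k.+1 w 0)^-1 *
     nu_dL L nu e (iter_op_to tauK L e
        (step_into tauK dL_op e (phi (iter k.+1 tau w) 0) : B (iter k tau w))))
   / Delta L nu phi w e).
  by apply: rearrange (iter_lam_neq0 _ _ _) (iter_lam_neq0 _ _ _) D_neq0 E.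
by rewrite mulr_suml; apply: eq_bigr => k _; rewrite -mulrA.
Qed.

End spectral.

(** * Real-valued moduli and double limits *)

Section modulus.
Context (R : realType).

Lemma rnormE (V : normedZmodType R[i]) (x : V) : (rnorm x)%:C%C = `|x|.
Proof. by rewrite /rnorm RRe_real // normr_real. Qed.

Lemma rnorm_ge0 (V : normedZmodType R[i]) (x : V) : 0 <= rnorm x.
Proof. by rewrite -ler0c rnormE. Qed.

Lemma rnormB_le (V : normedZmodType R[i]) (x y z : V) :
  rnorm (x - z) <= rnorm (x - y) + rnorm (y - z).
Proof. by rewrite -lecR rmorphD /= !rnormE ler_distD. Qed.

Lemma rnormBC (V : normedZmodType R[i]) (x y : V) :
  rnorm (x - y) = rnorm (y - x).
Proof. by rewrite /rnorm distrC. Qed.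

Lemma rnormZ (V : normedModType R[i]) (c : R[i]) (x : V) :
  rnorm (c *: x) = rnorm c * rnorm x.
Proof. by apply: complexI; rewrite rmorphM /= !rnormE normrZ. Qed.

Lemma rnormM (x y : R[i]) : rnorm (x * y) = rnorm x * rnorm y.
Proof. by apply: complexI; rewrite rmorphM /= !rnormE normrM. Qed.

Lemma rnorm_real (c : R) : 0 <= c -> rnorm (c%:C%C) = c.
Proof. by move=> c_ge0; rewrite /rnorm ger0_norm // ler0c. Qed.

(** Positive elements of R[i] are real, so it suffices to test convergence
    against real radii. *)
Lemma rnorm_cvgP (T : Type) (F : set_system T) {FF : Filter F}
    (V : normedModType R[i]) (f : T -> V) (l : V) :
  f @ F --> l <-> forall d : R, 0 < d -> \forall t \near F, rnorm (l - f t) < d.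
Proof.
split=> [/cvgrPdist_lt fl d d_gt0|fl].
  have := fl d%:C%C; rewrite ltcR => /(_ d_gt0).
  by apply: filterS => t; rewrite -rnormE ltcR.
apply/cvgrPdist_lt => d d_gt0.
have dE : d = (complex.Re d)%:C%C by rewrite RRe_real // gtr0_real.
have := fl (complex.Re d); rewrite -ltcR -dE => /(_ d_gt0).
by apply: filterS => t; rewrite -rnormE dE ltcR.
Qed.

Lemma Re_le_rnorm (z : R[i]) : `|complex.Re z| <= rnorm z.
Proof.
by rewrite /rnorm normc_def -sqrtr_sqr ler_wsqrtr // lerDl sqr_ge0.
Qed.

Lemma Im_le_rnorm (z : R[i]) : `|complex.Im z| <= rnorm z.
Proof.
by rewrite /rnorm normc_def -sqrtr_sqr ler_wsqrtr // lerDr sqr_ge0.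
Qed.

Lemma rnorm_le_ReIm (z : R[i]) :
  rnorm z <= `|complex.Re z| + `|complex.Im z|.
Proof.
have nneg : 0 <= `|complex.Re z| + `|complex.Im z| by rewrite addr_ge0.
rewrite /rnorm normc_def /= -[leRHS]ger0_norm // -sqrtr_sqr ler_wsqrtr //.
by rewrite sqrrD !real_normK ?num_real // addrAC lerDl mulrn_wge0 // mulr_ge0.
Qed.

(** Two late terms of s are both close to x t for a common t, hence close to
    each other. *)
Lemma real_double_limit (T : Type) (F : set_system T) {FF : ProperFilter F}
    (x : T -> R) (s : nat -> R) :
  (forall d : R, 0 < d ->
    \forall n \near \oo, \forall t \near F, `|x t - s n| < d) ->
  cvgn s.
Proof.
move=> xs; apply/cauchy_cvgP/cauchy_exP => d d_gt0.
have d2_gt0 : 0 < d / 2 by rewrite divr_gt0.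
have [N _ xsN] := xs _ d2_gt0.
exists (s N); exists N => // n /= Nn.
have [t [xtN xtn]] := filter_ex (filterI (xsN N (leqnn N)) (xsN n Nn)).
rewrite /ball /= (le_lt_trans (ler_distD (x t) _ _)) //.
by rewrite (splitr d) ltrD // distrC.
Qed.

(** A function of t that is approximated by constants S n, arbitrarily well for
    n large and t far along F, converges together with S to the same limit.
    Completeness enters through the real and imaginary parts. *)
Lemma complex_double_limit (T : Type) (F : set_system T) {FF : ProperFilter F}
    (X : T -> R[i]^o) (S : nat -> R[i]^o) :
  (forall d : R, 0 < d ->
    \forall n \near \oo, \forall t \near F, rnorm (X t - S n) < d) ->
  cvgn S /\ X @ F --> limn S.
Proof.
move=> XS.
have cvgRe : cvgn (fun n => complex.Re (S n)).
  apply: (real_double_limit (F := F) (x := fun t => complex.Re (X t))) => d /XS.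
  apply: filterS => n; apply: filterS => t; apply: le_lt_trans.
  by rewrite -raddfB Re_le_rnorm.
have cvgIm : cvgn (fun n => complex.Im (S n)).
  apply: (real_double_limit (F := F) (x := fun t => complex.Im (X t))) => d /XS.
  apply: filterS => n; apply: filterS => t; apply: le_lt_trans.
  by rewrite -raddfB Im_le_rnorm.
pose l : R[i] := Complex (limn (fun n => complex.Re (S n)))
                        (limn (fun n => complex.Im (S n))).
have Sl : S @ \oo --> (l : R[i]^o).
  apply/rnorm_cvgP => d d_gt0; have d2_gt0 : 0 < d / 2 by rewrite divr_gt0.
  near=> n; rewrite (le_lt_trans (rnorm_le_ReIm _)) // (splitr d) ltrD //.
    rewrite raddfB /=; near: n.
    by move/cvgrPdist_lt : cvgRe; apply.
  rewrite raddfB /=; near: n.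
  by move/cvgrPdist_lt : cvgIm; apply.
split; first exact: cvgP Sl.
have -> : limn S = l by apply: cvg_lim.
apply/rnorm_cvgP => d d_gt0; have d2_gt0 : 0 < d / 2 by rewrite divr_gt0.
have /rnorm_cvgP /(_ _ d2_gt0) Sld := Sl.
have [n [Sn XSn]] := filter_ex (filterI Sld (XS _ d2_gt0)).
near=> t.
rewrite (le_lt_trans (rnormB_le _ (S n) _)) // (splitr d) ltrD // rnormBC.
by near: t.
Unshelve. all: by end_near. Qed.

(** Scaling by c^-1 brings f into the unit ball; no continuity of g is assumed,
    so the right-hand side may be +oo. *)
Lemma le_dual_norm (V : normedModType R[i]) (g : V -> R[i]) (f : V) (c : R) :
  (forall (a : R[i]) v, g (a *: v) = a * g v) -> 0 < c -> rnorm f <= c ->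
  ((rnorm (g f))%:E <= c%:E * dual_norm g)%E.
Proof.
move=> gZ c_gt0 fc; have c_neq0 : c%:C%C != 0 :> R[i].
  by rewrite fmorph_eq0 gt_eqF.
rewrite -[f](scalerKV c_neq0) gZ rnormM rnorm_real ?(ltW c_gt0) // EFinM.
rewrite lee_pmul2l ?lte_fin //; apply: ereal_sup_ubound => /=.
exists (c%:C%C^-1 *: f) => //=.
rewrite -fmorphV rnormZ rnorm_real ?invr_ge0 ?(ltW c_gt0) //.
by rewrite ler_pdivrMl // mulr1.
Qed.

End modulus.

(** * Passage to the limit *)

Section limits.
Context (R : realType) (T : Type) (sigma tau : T -> T).
Context (tauK : cancel tau sigma) (B : T -> normedModType R[i]).
Context (eps0 : R) (eps0_gt0 : 0 < eps0).
Context (L Q : forall w, R -> {linear B w -> B (sigma w)}).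
Context (nu : forall w, R -> {linear B w -> R[i]^o}).
Context (lam : T -> R -> R[i]) (phi : forall w, R -> B w).
Hypothesis eigen : eigen_triple L nu lam phi eps0.

Local Notation backward_lam n w e := (iter_lam sigma lam n (iter n tau w) e).

Lemma eps_range0 : eps_range eps0 0.
Proof. by rewrite /eps_range /= lexx ltW. Qed.

Lemma near_eps_range : \forall e \near 0^'+, eps_range eps0 e.
Proof.
near=> e; apply/andP; split; near: e; first exact: nbhs_right_ge.
exact: nbhs_right_le.
Unshelve. all: by end_near. Qed.

(** The eigenvalue gap is the functional nu_{sigma w,0} o (L_0 - L_e), of norm
    eta, evaluated at phi_{w,e}, whose norm is bounded in e. *)
Lemma lam_cvg w : phi_bounded phi eps0 -> eta_cvg0 L nu ->
  (lam w e : R[i]^o) @[e --> 0^'+] --> (lam w 0 : R[i]^o).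
Proof.
move=> [C [C_ge0 phiC]] eta0; have h0 := eps_range0.
apply/rnorm_cvgP => d d_gt0.
(* C w itself may be 0, and the rescaling needs a positive bound. *)
have c_gt0 : 0 < C w + 1 by rewrite ltr_wpDl.
have /fine_cvgP[eta_fin /cvgrPdist_lt eta_small] := eta0 w.
near=> e.
have he : eps_range eps0 e by near: e; exact: near_eps_range.
rewrite -(nu_dL_phi eigen _ h0 he).
have phi_le : rnorm (phi w e) <= C w + 1.
  rewrite (@le_trans _ _ (C w)) ?lerDl // -lee_fin -phiC.
  by apply: ereal_sup_ubound; exists e.
have := le_dual_norm (fun a v => nu_dLZ L nu e a v) c_gt0 phi_le.
rewrite -lte_fin; move=> /le_lt_trans; apply.
have ef : (fine (Defs.eta L nu w e))%:E = Defs.eta L nu w e.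
  by rewrite fineK //; near: e.
rewrite -[dual_norm _]ef -EFinM lte_fin -ltr_pdivlMl //.
rewrite (le_lt_trans (ler_norm _)) // -normrN -[- _]add0r.
by near: e; apply: eta_small; rewrite mulr_gt0 ?invr_gt0.
Unshelve. all: by end_near. Qed.

Lemma iter_lam_cvg n w : phi_bounded phi eps0 -> eta_cvg0 L nu ->
  (iter_lam sigma lam n w e : R[i]^o) @[e --> 0^'+]
    --> (iter_lam sigma lam n w 0 : R[i]^o).
Proof.
move=> phiC eta0; elim: n => [|n IHn]; rewrite /iter_lam.
  by under eq_fun do rewrite big_ord0; rewrite big_ord0; exact: cvg_cst.
under eq_fun do rewrite big_ord_recr /=; rewrite big_ord_recr /=.
by apply: cvgM; [exact: IHn|exact: lam_cvg].
Qed.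

Local Notation S w := (series (fun k => qhat tauK L nu lam phi k w)).
Local Notation gap w e := ((lam w 0 - lam w e) / Delta L nu phi w e).
Local Notation remainder n w e :=
  ((Delta L nu phi w e)^-1
   * nu_dL L nu e (iter_op_to tauK Q e (phi (iter n tau w) 0))).

Lemma near_lt_limf_esup (f : R -> \bar R) (d : \bar R) :
  (limf_esup f 0^'+ < d)%E -> \forall e \near 0^'+, (f e < d)%E.
Proof.
move=> /ereal_inf_lt[_ [V V0 <-]] sup_lt; near=> e.
rewrite (le_lt_trans _ sup_lt) //; apply: ereal_sup_ubound.
by exists e => //; near: e.
Unshelve. all: by end_near. Qed.

Section main_term.
Hypothesis phiC : phi_bounded phi eps0.
Hypothesis eta0 : eta_cvg0 L nu.
Hypothesis nu_phi : nu_phi_cvg1 nu phi.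
Hypothesis q_lim : q_limits_exist tauK L nu phi eps0.

(** The formula for the eigenvalue gap with its remainder dropped, solved for the
    quotient (lam w 0 - lam w e) / Delta w e. *)
Definition main_term n w e : R[i]^o :=
  (nu (iter n tau w) e (phi (iter n tau w) 0))^-1
  * (backward_lam n w 0 / backward_lam n w e
    * (1 - \sum_(k < n) (backward_lam k.+1 w 0)^-1
                          * q_ratio tauK L nu phi k w e)).

(** The eigenvalue products cancel in the limit, and each q_ratio tends to q by
    the very definition of q as its limit. *)
Lemma main_term_cvg n w : Delta_pos L nu phi eps0 w ->
  main_term n w e @[e --> 0^'+] --> (1 - S w n : R[i]^o).
Proof.
move=> Dpos; have lam_neq0 := iter_lam_neq0 eigen n (iter n tau w) eps_range0.
have -> : 1 - S w n = 1^-1 * (backward_lam n w 0 / backward_lam n w 0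
    * (1 - \sum_(k < n) qhat tauK L nu lam phi k w)).
  by rewrite invr1 mul1r divff // mul1r /series /= big_mkord.
rewrite /main_term; apply: cvgM; first exact: cvgV (oner_neq0 _) (nu_phi _).
apply: cvgM.
  by apply: cvgM; [exact: cvg_cst|apply: cvgV => //; exact: iter_lam_cvg].
apply: cvgB; first exact: cvg_cst.
apply: (@cvg_big _ _ +%R 0 predT (@add_continuous R[i]^o)) => k _.
by apply: cvgM; [exact: cvg_cst|exact: q_lim].
Qed.

(** The error consists of 1 - S - main_term, eventually below d / 2, and of the
    remainder divided by a quantity that tends to 1. That divisor is eventually
    at least 1/2 in modulus, so a remainder below d / 4 contributes less than
    d / 2. *)
Lemma near_rnorm_gap n w (d : R) : spectral_decomposition L Q nu lam phi eps0 ->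
  Delta_pos L nu phi eps0 w -> 0 < d ->
  (limf_esup (fun e => (rnorm (remainder n.+1 w e))%:E) 0^'+ < (d / 4)%:E)%E ->
  \forall e \near 0^'+, rnorm (1 - gap w e - S w n.+1) < d.
Proof.
move=> dec Dpos d_gt0 /near_lt_limf_esup remainder_small.
have d2_gt0 : 0 < d / 2 by rewrite divr_gt0.
have /rnorm_cvgP main_small := main_term_cvg (n := n.+1) Dpos.
have nuV : (nu (iter n.+1 tau w) e (phi (iter n.+1 tau w) 0))^-1 @[e --> 0^'+]
    --> (1^-1 : R[i]^o) by exact: cvgV (oner_neq0 _) (nu_phi _).
near=> e.
have he : eps_range eps0 e by near: e; exact: near_eps_range.
have D_neq0 : Delta L nu phi w e != 0.
  have e_gt0 : 0 < e by near: e; exact: nbhs_right_gt.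
  by rewrite gt_eqF // Dpos // e_gt0; case/andP: he.
set x := nu (iter n.+1 tau w) e (phi (iter n.+1 tau w) 0).
have x_neq0 : x != 0.
  apply/eqP => x0.
  have : rnorm (1 - x) < 1.
    by rewrite /x; near: e; move/rnorm_cvgP : (nu_phi (iter n.+1 tau w)); apply.
  by rewrite x0 subr0 (rnorm_real (c := 1)) ?ltxx.
have xV_lt2 : rnorm x^-1 < 2.
  have : rnorm (1^-1 - x^-1) < 1.
    by rewrite /x; near: e; move/rnorm_cvgP : nuV; apply.
  have := rnormB_le (x^-1) 1 0; rewrite !subr0 invr1 rnormBC.
  rewrite (rnorm_real (c := 1)) // => le lt.
  by rewrite (le_lt_trans le) // (_ : 2 = 1 + 1 :> R) // ltrD2r.
have gapE : gap w e = main_term n.+1 w e - x^-1 * remainder n.+1 w e.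
  rewrite /main_term -/x -mulrBr -(eigenvalue_gap tauK eigen dec) ?mulKf //.
  exact: eps_range0.
have -> : 1 - gap w e - S w n.+1 =
    (1 - S w n.+1 - main_term n.+1 w e) - (- (x^-1 * remainder n.+1 w e)).
  by rewrite gapE; ring.
rewrite (le_lt_trans (rnormB_le _ 0 _)) // subr0 sub0r opprK (splitr d) ltrD //.
  by near: e; exact: main_small.
rewrite rnormM (_ : d / 2 = 2 * (d / 4)); last by field.
rewrite ltr_pM ?rnorm_ge0 // -lte_fin.
by near: e.
Unshelve. all: by end_near. Qed.

Lemma gap_double_limit w (d : R) : spectral_decomposition L Q nu lam phi eps0 ->
  remainder_vanishes tauK L Q nu phi eps0 ->
  Delta_pos L nu phi eps0 w -> 0 < d ->
  \forall n \near \oo, \forall e \near 0^'+, rnorm (1 - gap w e - S w n) < d.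
Proof.
move=> dec rem0 Dpos d_gt0.
have d4_gt0 : (0 < (d / 4)%:E)%E by rewrite lte_fin divr_gt0.
have limsup_small : \forall n \near \oo,
    (limf_esup (fun e => (rnorm (remainder n w e))%:E) 0^'+ < (d / 4)%:E)%E.
  exact: rem0 Dpos _ (open_ereal_lt' d4_gt0).
(* The gap formula holds for at least one step, so n = 0 is excluded. *)
apply: filterS2 limsup_small (nbhs_infty_gt 0) => -[//|n] small _.
exact: near_rnorm_gap small.
Qed.

End main_term.

End limits.

Theorem theorem6 (R : realType) (d : measure_display) (Omega : measurableType d)
    (m : probability Omega R)
    (sigma tau : Omega -> Omega)
    (sigmaK : cancel sigma tau) (tauK : cancel tau sigma)
    (sigma_mp : measure_preserving m sigma) (sigma_erg : ergodic m sigma)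
    (B : Omega -> normedModType R[i])
    (eps0 : R) (eps0_gt0 : 0 < eps0)
    (L : forall w, R -> {linear B w -> B (sigma w)})
    (nu : forall w, R -> {linear B w -> R[i]^o})
    (lam : Omega -> R -> R[i])
    (phi : forall w, R -> B w)
    (Q : forall w, R -> {linear B w -> B (sigma w)})
    (P1 : uniformly_bounded L eps0)
    (P2 : eigen_triple L nu lam phi eps0)
    (P3 : spectral_decomposition L Q nu lam phi eps0)
    (P4 : phi_bounded phi eps0)
    (P5 : eta_cvg0 L nu)
    (P6 : eta_controlled_by_Delta L nu phi eps0)
    (P7 : nu_phi_cvg1 nu phi)
    (P8 : remainder_vanishes tauK L Q nu phi eps0)
    (P9 : q_limits_exist tauK L nu phi eps0) :
  {ae m, forall w, Delta_pos L nu phi eps0 w ->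
    cvgn (series (fun k => qhat tauK L nu lam phi k w)) /\
    ((lam w 0 - lam w e) / Delta L nu phi w e : R[i]^o) @[e --> 0^'+]
      --> theta tauK L nu lam phi w}.
Proof.
apply: aeW => w Dpos.
pose gap e : R[i]^o := (lam w 0 - lam w e) / Delta L nu phi w e.
have [cvgS gapS] : cvgn (series (fun k => qhat tauK L nu lam phi k w)) /\
    (1 - gap e : R[i]^o) @[e --> 0^'+]
      --> limn (series (fun k => qhat tauK L nu lam phi k w)).
  apply: complex_double_limit => d' d'_gt0.
  exact: (gap_double_limit eps0_gt0 P2 P4 P5 P7 P9 P3 P8 Dpos d'_gt0).
split; first exact: cvgS.
have -> : (fun e => (lam w 0 - lam w e) / Delta L nu phi w e : R[i]^o)
    = (fun e => 1 - (1 - gap e) : R[i]^o).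
  by apply/funext => e; rewrite subKr.
by apply: cvgB; [exact: cvg_cst|exact: gapS].
Qed.
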